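(* For all $d,b,k$ fix $\mathcal{R}_{d,b}^k$ to be either $\mathcal{H}_{d,b}^k$ or $\widetilde{\mathcal{H}}_{d,b}^k$. For any integer $d\ge 1$ and any sequence of positive integers $b=b(n)\to\infty$ with $n/(b\log b)\to\infty$, there exist a sequence of positive integers $k=k(n)\to\infty$ and an estimator (a sequence of estimators) $V_n\in\mathcal{R}_{d,b}^k$ such that, for all $\varepsilon>0$, $$\sup_{p\in\mathcal{D}_d}P\left(\|V_n-p\|>3\min_{q\in\mathcal{R}_{d,b}^k}\|p-q\|+\varepsilon\right)\to 0\quad\text{as } n\to\infty,$$ where $V_n$ is a function of $X_1,\ldots,X_n\overset{iid}{\sim}p$.
   Context: $\mathcal{D}_d$ is the set of all probability densities (with respect to Lebesgue measure) on $[0,1)^d$, and $\|\cdot\|$ is the $L^1$ norm. $[b]=\{1,\ldots,b\}$; $\Delta_k$ is the set of probability vectors in $\mathbb{R}^k$ and $\mathcal{T}_{d,k}$ the set of probability tensors in $\mathbb{R}^{k\times\cdots\times k}$ ($d$ modes), where ''probability'' means nonnegative entries summing to one. For $i\in[b]$ let $h_{1,b,i}(x)=b\,\mathbf{1}\left(\frac{i-1}{b}\le x<\frac{i}{b}\right)$ on $[0,1)$, and let $\mathcal{H}_{1,b}=\operatorname{Conv}\{h_{1,b,i}: i\in[b]\}$. The product symbol between functions denotes the outer (tensor) product: $\left(\prod_{j=1}^d f_j\right)(x_1,\ldots,x_d)=f_1(x_1)\cdots f_d(x_d)$. The sets of multi-view and Tucker histograms are $$\mathcal{H}_{d,b}^k=\left\{\sum_{i=1}^k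 w_i\prod_{j=1}^d f_{i,j}\;\middle|\; w\in\Delta_k,\ f_{i,j}\in\mathcal{H}_{1,b}\right\},\qquad \widetilde{\mathcal{H}}_{d,b}^k=\left\{\sum_{S\in[k]^d}W_S\prod_{i=1}^d f_{i,S_i}\;\middle|\; W\in\mathcal{T}_{d,k},\ f_{i,j}\in\mathcal{H}_{1,b}\right\}.$$ An estimator $V_n\in\mathcal{R}_{d,b}^k$ is a (measurable) map, not depending on $p$ or $\varepsilon$, from samples $(X_1,\ldots,X_n)\in([0,1)^d)^n$ to $\mathcal{R}_{d,b(n)}^{k(n)}$; $P$ is the probability over $X_1,\ldots,X_n$ iid with density $p$. *)

(* Defs.v *)
From HB Require Import structures.
From mathcomp Require Import all_boot all_order all_algebra.
From mathcomp Require Import all_classical all_reals all_analysis.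

Set Implicit Arguments.
Unset Strict Implicit.
Unset Printing Implicit Defensive.
Import Order.TTheory GRing.Theory Num.Theory.
Import numFieldNormedType.Exports.

Local Open Scope classical_set_scope.
Local Open Scope ring_scope.

Section power_measure_def.
Context {disp : measure_display} {T : measurableType disp} {R : realType}.
Variable mu : set T -> \bar R.
Local Open Scope ereal_scope.

(* The [n]-fold product of [mu] with itself: the law of an iid sample of size
   [n] when [mu] is a probability, and Lebesgue measure on R^n when [mu] is
   Lebesgue measure on R. *)
Fixpoint power_measure (n : nat) : set (n.-tuple T) -> \bar R :=
  match n with
  | 0 => \d_[tuple]
  | n'.+1 => fun A =>
      (mu \x @power_measure n')
        ((fun xs : T * n'.-tuple T => [tuple of xs.1 :: xs.2]) @^-1` A)
  end.

End power_measure_def.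
Arguments power_measure {disp T R} mu n A.

Section power_measure.
Context {disp : measure_display} {T : measurableType disp} {R : realType}.
Local Open Scope ereal_scope.
Variable mu : {sigma_finite_measure set T -> \bar R}.

Let consT n (xs : T * n.-tuple T) := [tuple of xs.1 :: xs.2].

Let measurable_consT n : measurable_fun setT (@consT n).
Proof. exact: measurable_cons. Qed.

Let preimage_consT n (A : set (n.+1.-tuple T)) :
  measurable A -> measurable (@consT n @^-1` A).
Proof. by move=> mA; rewrite -[X in measurable X]setTI; exact: measurable_consT. Qed.

Let unconsT n (t : n.+1.-tuple T) : T * n.-tuple T :=
  (thead t, [tuple of behead t]).

Let consTK n : cancel (@consT n) (@unconsT n).
Proof. by case=> x s; rewrite /unconsT theadE; congr pair; exact/val_inj. Qed.

Let measurable_unconsT n : measurable_fun setT (@unconsT n).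
Proof.
apply: measurable_fun_pair; [exact: measurable_tnth|exact: measurable_behead].
Qed.

Let power_measureP n :
  exists nu : {sigma_finite_measure set (n.-tuple T) -> \bar R},
    nu = power_measure mu n :> (_ -> _).
Proof.
elim: n => [|n [nu nuE]]; first by exists \d_([tuple] : 0.-tuple T).
pose m : set (n.+1.-tuple T) -> \bar R := pushforward (mu \x nu) (@consT n).
have m0 : m set0 = 0 by rewrite /m /pushforward preimage_set0 measure0.
have mge0 A : 0 <= m A by rewrite /m /pushforward measure_ge0.
have madd : semi_sigma_additive m.
  move=> F mF tF mUF; rewrite /m /pushforward preimage_bigcup.
  apply: measure_semi_sigma_additive.
  - by move=> i; exact: preimage_consT.
  - apply/trivIsetP => i j _ _ ij; rewrite -preimage_setI.
    by move/trivIsetP : tF => /(_ _ _ Logic.I Logic.I ij) ->; rewrite preimage_set0.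
  - by rewrite -preimage_bigcup; exact: preimage_consT.
have sfm : sigma_finite setT m.
  have /sigma_finiteP[F [TF ndF Foo]] := sigma_finiteT mu.
  have /sigma_finiteP[G [TG ndG Goo]] := sigma_finiteT nu.
  exists (fun i => @unconsT n @^-1` (F i `*` G i)).
    apply/seteqP; split => // t _.
    have [i _ Fi] : (\bigcup_i F i) (unconsT t).1 by rewrite -TF.
    have [j _ Gj] : (\bigcup_i G i) (unconsT t).2 by rewrite -TG.
    exists (maxn i j) => //; split.
      by move: Fi; exact/subsetPset/ndF/leq_maxl.
    by move: Gj; exact/subsetPset/ndG/leq_maxr.
  move=> i; have [mFi Fi] := Foo i; have [mGi Gi] := Goo i; split.
    rewrite -[X in measurable X]setTI; apply: measurable_unconsT => //.
    exact: measurableX.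
  rewrite /m /pushforward (_ : _ @^-1` _ = F i `*` G i).
    by rewrite product_measure1E// lte_mul_pinfty// ge0_fin_numE.
  by apply/funext => xs; exact: (congr1 (F i `*` G i) (consTK xs)).
pose isM := isMeasure.Build _ _ _ m m0 mge0 madd.
pose M : {measure set _ -> \bar R} := HB.pack m isM.
pose isSF := Measure_isSigmaFinite.Build _ _ _ M sfm.
pose N : {sigma_finite_measure set (n.+1.-tuple T) -> \bar R} := HB.pack m isM isSF.
by exists N; rewrite /= -nuE.
Qed.

Let power_measure0 n : power_measure mu n set0 = 0.
Proof. by have [nu <-] := power_measureP n; rewrite measure0. Qed.

Let power_measure_ge0 n A : 0 <= power_measure mu n A.
Proof. by have [nu <-] := power_measureP n; rewrite measure_ge0. Qed.

Let power_measure_sigma_additive n : semi_sigma_additive (power_measure mu n).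
Proof. by have [nu <-] := power_measureP n; exact: measure_semi_sigma_additive. Qed.

HB.instance Definition _ n := isMeasure.Build _ _ _ (power_measure mu n)
  (power_measure0 n) (@power_measure_ge0 n) (@power_measure_sigma_additive n).

Let power_measure_sigma_finite n : sigma_finite setT (power_measure mu n).
Proof. by have [nu <-] := power_measureP n; exact: sigma_finiteT. Qed.

HB.instance Definition _ n := Measure_isSigmaFinite.Build _ _ _
  (power_measure mu n) (power_measure_sigma_finite n).

Lemma power_measure_box n (A : 'I_n -> set T) : (forall i, measurable (A i)) ->
  power_measure mu n [set x | forall i, A i (tnth x i)] = \prod_(i < n) mu (A i).
Proof.
elim: n A => [|n IH] A mA.
  by rewrite big_ord0 /= diracE mem_set// => -[].
rewrite big_ord_recl/= -IH; last by move=> i; exact: mA.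
rewrite -product_measure1E//; last first.
  rewrite (_ : [set _ | _] = \bigcap_(i in [set: 'I_n]) (fun x => tnth x i) @^-1` (A (lift ord0 i))); last first.
    by apply/seteqP; split=> [x h i _|x h i]; [exact: h|exact: (h i)].
  apply: fin_bigcap_measurable => // i _.
  by rewrite -[X in measurable X]setTI; exact: measurable_tnth.
congr (_ _); apply/seteqP; split=> [[x s] /= h|[x s] /= [h0 h] i].
  split; first by have := h ord0; rewrite tnth0.
  by move=> i; have := h (lift ord0 i); rewrite tnthS.
by case: (unliftP ord0 i) => [j|] ->; rewrite ?tnthS ?tnth0.
Qed.

End power_measure.

Notation Rvec R d := (d.-tuple (measurableTypeR R)).

(* A function on [0, 1)^d is represented by its extension by zero to R^d. *)
Section densities.
Context {R : realType}.

Definition cube (d : nat) : set (Rvec R d) :=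
  [set x | forall i, 0 <= (tnth x i : R) < 1].
Arguments cube d x : clear implicits.

Definition lebesgue_vec (d : nat) : set (Rvec R d) -> \bar R :=
  power_measure lebesgue_measure d.
Arguments lebesgue_vec d A : clear implicits.

HB.instance Definition _ d := SigmaFiniteMeasure.on (lebesgue_vec d).

Definition densities (d : nat) : set (Rvec R d -> R) :=
  [set p : Rvec R d -> R | [/\ measurable_fun setT p, (forall x, 0 <= p x),
               (forall x, ~ cube d x -> p x = 0) &
               (\int[lebesgue_vec d]_x (p x)%:E = 1)%E ]].

Definition L1dist (d : nat) (f g : Rvec R d -> R) : \bar R :=
  ('N[lebesgue_vec d]_1[EFin \o (f \- g)%R])%E.

Definition density_law (d : nat) (p : Rvec R d -> R) : set (Rvec R d) -> \bar R :=
  fun A => (\int[lebesgue_vec d]_(x in A) (p x)%:E)%E.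

Definition sample_law (d n : nat) (p : Rvec R d -> R) :
    set (n.-tuple (Rvec R d)) -> \bar R :=
  power_measure (density_law p) n.

End densities.
Arguments cube {R} d x.
Arguments lebesgue_vec {R} d A.
Arguments densities {R} d p.
Arguments density_law {R d} p A.
Arguments sample_law {R d} n p A.

Section histograms.
Context {R : realType}.

Definition prob_weights (I : finType) (w : I -> R) :=
  (forall i, 0 <= w i) /\ \sum_i w i = 1.

(* The bins are indexed from 0. *)
Definition hist1_bin (b : nat) (i : 'I_b) (x : R) : R :=
  b%:R * \1_(`[i%:R / b%:R, i.+1%:R / b%:R[ : set R) x.

(* Conv {h_(1,b,i)} *)
Definition hist1 (b : nat) : set (R -> R) :=
  [set f | exists2 w : 'I_b -> R, prob_weights w &
     f = fun x => \sum_i w i * hist1_bin i x].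
Arguments hist1 b f : clear implicits.

Definition multiview_hist (d b k : nat) : set (Rvec R d -> R) :=
  [set q | exists w : 'I_k -> R, exists f : 'I_k -> 'I_d -> R -> R,
     [/\ prob_weights w, (forall i j, hist1 b (f i j)) &
         q = fun x => \sum_i w i * \prod_j f i j (tnth x j)]].

(* A tensor with d modes of size k is a function of the multi-index S. *)
Definition tucker_hist (d b k : nat) : set (Rvec R d -> R) :=
  [set q | exists W : {ffun 'I_d -> 'I_k} -> R, exists f : 'I_d -> 'I_k -> R -> R,
     [/\ prob_weights W, (forall i j, hist1 b (f i j)) &
         q = fun x => \sum_S W S * \prod_i f i (S i) (tnth x i)]].

End histograms.
Arguments hist1 {R} b f.
Arguments multiview_hist {R} d b k q.
Arguments tucker_hist {R} d b k q.

Section estimators.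
Context {R : realType}.

(* The values lie in a finite-dimensional space of functions, so measurability
   as a random element of L^1 amounts to joint measurability in the sample and
   the evaluation point. *)
Definition estimator (d n : nat) (Q : set (Rvec R d -> R))
    (V : n.-tuple (Rvec R d) -> Rvec R d -> R) :=
  measurable_fun setT (fun Xx : n.-tuple (Rvec R d) * Rvec R d => V Xx.1 Xx.2)
  /\ forall X, Q (V X).

(* The minimum of the L^1 distance over the (L^1-compact) class is rendered as
   an infimum. *)
Definition best_approx (d : nat) (Q : set (Rvec R d -> R)) (p : Rvec R d -> R) :
    \bar R :=
  ereal_inf [set L1dist p q | q in Q].

End estimators.

(* Main.v *)
(** Minimum-distance (Yatracos) selection from a finite net.  Discretizing the
    weights of the histogram factors on a grid of mesh [1 / M], with [M]
    proportional to [b], gives a [1 / k]-net of the class, made of elements of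
    the class, of cardinality at most [(C b) ^ (D b)] where [C] and [D] depend
    only on [d] and [k].  Let [V_n] be the element [q] of the net minimizing the
    largest gap between [q] and the empirical measure over the sets
    [{q_j < q_i}].  By Scheffe's identity [||f - g|| = 2 (f - g)({g < f})] for
    probability densities, [V_n] is within [3 min + 4 t] of [p] as soon as the
    empirical measure is [t]-close to [p] on these sets; by Chernoff's bound this
    fails with probability at most [2 N^2 exp (- n t^2 / 8)] for a net of size
    [N].  Since [ln N <= D (ln C + 1) b ln b] and [n / (b ln b)] tends to infinity,
    [k] can be made to grow slowly enough for this to vanish uniformly in [p]. *)
Require Import Defs.
From HB Require Import structures.
From mathcomp Require Import all_boot all_order all_algebra.
From mathcomp Require Import all_classical all_reals all_analysis.
From mathcomp Require Import measurable_realfun.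
From mathcomp Require Import ring lra.

Set Implicit Arguments.
Unset Strict Implicit.
Unset Printing Implicit Defensive.
Import Order.TTheory GRing.Theory Num.Theory.
Import numFieldNormedType.Exports.

Local Open Scope classical_set_scope.
Local Open Scope ring_scope.

(** * Integration of product functions against power measures *)

Section power_measure_integral.
Context {disp : measure_display} {T : measurableType disp} {R : realType}.
Variable mu : {sigma_finite_measure set T -> \bar R}.
Local Open Scope ereal_scope.

(** Independence in integral form: by induction on [n], Tonelli's theorem splits off the first
    coordinate. *)
Lemma integral_power_measure_prod n (g : 'I_n -> T -> R) :
  (forall i, measurable_fun setT (g i)) -> (forall i x, (0 <= g i x)%R) ->
  \int[power_measure mu n]_X (\prod_i g i (tnth X i))%:E =
  \prod_i \int[mu]_x (g i x)%:E.
Proof.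
elim: n g => [|n IH] g mg g0.
  rewrite [in RHS]big_ord0 integral_dirac//=.
    by rewrite [d in d * _]diracE mem_set// mul1e big_ord0.
  by under eq_fun do rewrite big_ord0; exact: measurable_cst.
pose c (xs : T * n.-tuple T) : n.+1.-tuple T := [tuple of xs.1 :: xs.2].
have mc : measurable_fun setT c by exact: measurable_cons.
pose F (X : n.+1.-tuple T) : \bar R := (\prod_i g i (tnth X i))%:E.
have mF : measurable_fun setT F.
  apply/measurable_EFinP/measurable_prod => i _.
  by apply: measurableT_comp (mg i) _; exact: measurable_tnth.
have F0 X : 0 <= F X by rewrite lee_fin prodr_ge0.
(* The power measure of exponent [n.+1] is by definition the pushforward of the product measure
   along [c]. *)
transitivity (\int[pushforward (mu \x power_measure mu n) c]_X F X) => //.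
rewrite ge0_integral_pushforward// preimage_setT fubini_tonelli1//=; last first.
  exact: measurableT_comp.
rewrite big_ord_recl -IH//.
pose G (X : n.-tuple T) : R := (\prod_i g (lift ord0 i) (tnth X i))%R.
have mG : measurable_fun setT G.
  apply/measurable_prod => i _.
  by apply: measurableT_comp (mg _) _; exact: measurable_tnth.
have G0 X : (0 <= G X)%R by rewrite prodr_ge0.
rewrite -ge0_integralZr//; first last.
- by apply: integral_ge0 => X _; rewrite lee_fin; exact: G0.
- by move=> x _; rewrite lee_fin.
- exact/measurable_EFinP.
apply: eq_integral => x _; rewrite /fubini_F.
rewrite -ge0_integralZl ?lee_fin//; first last.
- by move=> X _; rewrite lee_fin; exact: G0.
- exact/measurable_EFinP.
apply: eq_integral => X _; rewrite -EFinM /F /c /= big_ord_recl tnth0.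
by congr (_ * _)%:E; apply: eq_bigr => i _; rewrite tnthS.
Qed.

End power_measure_integral.

(** * Chernoff bounds for empirical frequencies *)

Section concentration.
Context {disp : measure_display} {T : measurableType disp} {R : realType}.
Variable P : probability T R.
Local Open Scope ereal_scope.

(** Since [expR (- x) >= 1 - x], it suffices that [(1 - x) * (1 + x + 2 * x ^+ 2) = 1 + x ^+ 2 * (1
    - 2 * x)] is at least [1]. *)
Lemma expR_le_quadratic (x : R) : (x <= 2^-1 -> expR x <= 1 + x + 2 * x ^+ 2)%R.
Proof.
move=> hx; have h := expR_ge1Dx (- x).
have e0 := expR_gt0 x.
have : (expR x * expR (- x) = 1)%R by rewrite -expRD subrr expR0.
nra.
Qed.

(** The integrand takes two values, with probabilities [a] and [1 - a]. In the quadratic bound the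
    linear terms cancel, which leaves [1 + 2 * l ^+ 2 * (a * (1 - a))]. *)
Lemma indicator_mgf_le (A : set T) (l : R) : measurable A -> (`|l| <= 2^-1)%R ->
  \int[P]_x (expR (l * (\1_A x - fine (P A))))%:E <= (expR (2 * l ^+ 2))%:E.
Proof.
move=> mA hl.
set a := fine (P A).
have Pa : P A = a%:E by rewrite fineK// fin_num_measure.
have PCa : P (~` A) = (1 - a)%:E by rewrite probability_setC// Pa.
have a0 : (0 <= a)%R by rewrite fine_ge0.
have a1 : (a <= 1)%R by rewrite -lee_fin -Pa probability_le1.
have mf : measurable_fun setT (fun x => (expR (l * (\1_A x - a)))%:E).
  apply/measurable_EFinP; apply: measurableT_comp => //.
  apply: measurable_funM => //; apply: measurable_funB => //.
have -> : \int[P]_x (expR (l * (\1_A x - a)))%:E =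
   (expR (l * (1 - a)) * a + expR (l * (- a)) * (1 - a))%:E.
  rewrite -(setUv A) ge0_integral_setU//; first last.
  - by rewrite disj_set2E setICr.
  - by rewrite setUv.
  - exact: measurableC.
  rewrite EFinD !EFinM -Pa -PCa; congr (_ + _).
    rewrite -integral_cst//; apply: eq_integral => x xA.
    by rewrite indicE xA.
  rewrite -integral_cst; last exact: measurableC.
  apply: eq_integral => x; rewrite in_setC indicE => /negbTE ->.
  by rewrite sub0r.
rewrite lee_fin.
have h1 : (expR (l * (1 - a)) <= 1 + l * (1 - a) + 2 * (l * (1 - a)) ^+ 2)%R.
  by apply: expR_le_quadratic; move: hl; rewrite ler_norml => /andP[]; nra.
have h2 : (expR (l * - a) <= 1 + l * - a + 2 * (l * - a) ^+ 2)%R.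
  by apply: expR_le_quadratic; move: hl; rewrite ler_norml => /andP[]; nra.
apply: (le_trans _ (expR_ge1Dx _)).
have h3 : (expR (l * (1 - a)) * a <= (1 + l * (1 - a) + 2 * (l * (1 - a)) ^+ 2) * a)%R.
  exact: ler_wpM2r.
have h4 : (expR (l * - a) * (1 - a) <= (1 + l * - a + 2 * (l * - a) ^+ 2) * (1 - a))%R.
  by apply: ler_wpM2r => //; lra.
have l2 : (0 <= l ^+ 2)%R by exact: sqr_ge0.
apply: (le_trans (lerD h3 h4)).
have -> : ((1 + l * (1 - a) + 2 * (l * (1 - a)) ^+ 2) * a +
  (1 + l * - a + 2 * (l * - a) ^+ 2) * (1 - a) = 1 + 2 * l ^+ 2 * (a * (1 - a)))%R by ring.
rewrite lerD2l ler_piMr//; nra.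
Qed.

Lemma sum_deviation_mgf_le n (A : set T) (l : R) : measurable A -> (`|l| <= 2^-1)%R ->
  \int[power_measure P n]_X (expR (l * \sum_(i < n) (\1_A (tnth X i) - fine (P A))))%:E
    <= (expR (2 * l ^+ 2 * n%:R))%:E.
Proof.
move=> mA hl.
under eq_integral do rewrite mulr_sumr expR_sum.
rewrite (@integral_power_measure_prod _ _ _ P n
  (fun=> fun x => expR (l * (\1_A x - fine (P A)))))//; last first.
  move=> i; apply: measurableT_comp => //.
  by apply: measurable_funM => //; apply: measurable_funB.
rewrite (_ : (2 * l ^+ 2 * n%:R = \sum_(i < n) 2 * l ^+ 2)%R); last first.
  by rewrite sumr_const card_ord mulr_natr.
rewrite expR_sum -prodEFin.
elim: n => [|n IH]; first by rewrite !big_ord0.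
rewrite !big_ord_recl lee_pmul ?indicator_mgf_le//.
  by apply: integral_ge0 => x _; rewrite lee_fin expR_ge0.
by apply: prode_ge0 => i _; apply: integral_ge0 => x _; rewrite lee_fin expR_ge0.
Qed.

(* The exponential tilt in Chernoff's bound is [t / 4]. *)
Lemma uniform_deviation n (I : finType) (A : I -> set T) (t : R)
    (B : set (n.-tuple T)) :
  (forall i, measurable (A i)) -> (0 < t <= 2)%R -> measurable B ->
  (forall X, B X -> exists i,
     (n%:R * t < `|\sum_(j < n) (\1_(A i) (tnth X j) - fine (P (A i)))|)%R) ->
  power_measure P n B <= (2 * #|I|%:R * expR (- (t ^+ 2 / 8) * n%:R))%:E.
Proof.
move=> mA /andP[t0 t2] mB hB.
pose S i X : R := (\sum_(j < n) (\1_(A i) (tnth X j) - fine (P (A i))))%R.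
(* Both signs of the tilt are needed for a two-sided bound; [t <= 2] keeps its size below
   [1 / 2]. *)
pose l (s : bool) : R := ((-1) ^+ s * (t / 4))%R.
have lle s : (`|l s| <= 2^-1)%R.
  rewrite /l normrM normrX normrN1 expr1n mul1r ger0_norm; lra.
have l2 s : (l s ^+ 2 = t ^+ 2 / 16)%R by rewrite /l exprMn sqrr_sign; field.
pose e (k : I * bool) X : R := (expR (- (t ^+ 2 / 4) * n%:R) * expR (l k.2 * S k.1 X))%R.
have mS i : measurable_fun setT (S i).
  apply: measurable_sum => j; apply: measurable_funB => //.
  by apply: measurableT_comp; [exact: measurable_indic|exact: measurable_tnth].
have mE k : measurable_fun setT (fun X => expR (l k.2 * S k.1 X)).
  by apply: measurableT_comp => //; apply: measurable_funM.
have me k : measurable_fun setT (fun X => (e k X)%:E).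
  by apply/measurable_EFinP; apply: measurable_funM.
have e0 k X : (0 <= e k X)%R by rewrite mulr_ge0 ?expR_ge0.
apply: (@le_trans _ _ (\int[power_measure P n]_X \sum_k (e k X)%:E)).
  have <- : \int[power_measure P n]_X (\1_B X)%:E = power_measure P n B.
    by rewrite integral_indic// setIT.
  apply: ge0_le_integral => //.
  - exact/measurable_EFinP.
  - exact: emeasurable_sum.
  move=> X _; rewrite indicE; have [|_] := boolP (X \in B); last first.
    by apply: sume_ge0 => k _; rewrite lee_fin.
  rewrite inE => /hB[i hi].
  (* On [B] one term of the sum is already at least [1]: the deviating index, with the tilt signed
     like the deviation, has exponent [t / 4 * |S i X| - n t ^+ 2 / 4 >= 0]. *)
  rewrite (bigD1 (i, S i X < 0)%R)//= -[leLHS]adde0 leeD//; last first.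
    by apply: sume_ge0 => k _; rewrite lee_fin.
  rewrite lee_fin /e /= -expRD -[leLHS]expR0 ler_expR.
  have -> : (l (S i X < 0) * S i X = t / 4 * `|S i X|)%R.
    rewrite /l; case: ltrP => h; rewrite ?expr1 ?expr0; first by rewrite ltr0_norm//; ring.
    by rewrite ger0_norm//; ring.
  by rewrite -/(S i X) in hi; nra.
rewrite ge0_integral_sum//; last by move=> k X _; rewrite lee_fin.
apply: (@le_trans _ _ (\sum_(k : I * bool) (expR (- (t ^+ 2 / 8) * n%:R))%:E)).
  apply: lee_sum => k _.
  rewrite /e; under eq_integral do rewrite EFinM.
  rewrite ge0_integralZl ?lee_fin ?expR_ge0//; first last.
  - exact/measurable_EFinP.
  (* The exponents add up to [- t ^+ 2 / 4 + 2 * (t ^+ 2 / 16) = - t ^+ 2 / 8] per observation. *)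
  apply: (le_trans (lee_wpmul2l _ (sum_deviation_mgf_le _ _ _))) => //.
  by rewrite -EFinM -expRD lee_fin ler_expR l2; lra.
rewrite sumEFin lee_fin sumr_const card_prod card_bool mulnC -[leLHS]mulr_natl natrM.
by [].
Qed.

End concentration.

(** * Scheffe's identity and Yatracos selection *)

Section scheffe.
Context {disp : measure_display} {T : measurableType disp} {R : realType}.
Variable mu : {measure set T -> \bar R}.

Let integrableT f (A : set T) : measurable A ->
  mu.-integrable setT (EFin \o f) -> mu.-integrable A (EFin \o f).
Proof. by move=> mA; exact: integrableS. Qed.

Lemma Rintegral_setUC (A : set T) (f : T -> R) : measurable A ->
  mu.-integrable setT (EFin \o f) ->
  \int[mu]_x f x = \int[mu]_(x in A) f x + \int[mu]_(x in ~` A) f x.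
Proof.
move=> mA fi; rewrite -Rintegral_setU ?setUv//; first exact: measurableC.
by rewrite disj_set2E setICr.
Qed.

(** The integrals of [f] over [A] and its complement are opposite, and each is dominated by the
    integral of [|f|] over the same set. *)
Lemma scheffe_ub (A : set T) (f : T -> R) : measurable A ->
  mu.-integrable setT (EFin \o f) -> \int[mu]_x f x = 0 ->
  2 * `|\int[mu]_(x in A) f x| <= \int[mu]_x `|f x|.
Proof.
move=> mA fi f0; have mCA := measurableC mA.
have nfi := integrable_norm fi.
have := le_normr_Rintegral mA (integrableT mA fi).
have := le_normr_Rintegral mCA (integrableT mCA fi).
rewrite (Rintegral_setUC mA nfi).
move: f0; rewrite (Rintegral_setUC mA fi) => /eqP; rewrite addrC addr_eq0 => /eqP ->.
by rewrite normrN; lra.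
Qed.

(** The positive and negative parts of a function of zero integral have equal mass. *)
Lemma scheffe_eq (f : T -> R) :
  mu.-integrable setT (EFin \o f) -> \int[mu]_x f x = 0 ->
  \int[mu]_x `|f x| = 2 * \int[mu]_(x in [set x | 0 < f x]) f x.
Proof.
move=> fi f0; set A := [set x | _].
have mA : measurable A.
  have /measurable_EFinP mf := measurable_int mu fi.
  rewrite (_ : A = f @^-1` `]0, +oo[).
    by rewrite -[X in measurable X]setTI; exact: mf.
  by apply/seteqP; split => x; rewrite /A /= in_itv/= andbT.
have mCA := measurableC mA.
have nfi := integrable_norm fi.
rewrite (Rintegral_setUC mA nfi).
move: f0; rewrite (Rintegral_setUC mA fi) => f0.
have -> : \int[mu]_(x in A) `|f x| = \int[mu]_(x in A) f x.
  by apply: eq_Rintegral => x; rewrite inE => h; rewrite gtr0_norm.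
have -> : \int[mu]_(x in ~` A) `|f x| = - \int[mu]_(x in ~` A) f x.
  rewrite -[RHS]mulN1r -RintegralZl//; last exact: integrableT.
  apply: eq_Rintegral => x; rewrite inE => /negP; rewrite -leNgt => h.
  by rewrite ler0_norm// mulN1r.
lra.
Qed.

Lemma integrable_sub (f g : T -> R) : mu.-integrable setT (EFin \o f) ->
  mu.-integrable setT (EFin \o g) ->
  mu.-integrable setT (EFin \o (fun x => f x - g x)).
Proof.
move=> fi gi.
by rewrite (_ : _ \o _ = (EFin \o f) \- (EFin \o g))%E//; exact: integrableB.
Qed.

Lemma Rintegral_dist_triangle (f g h : T -> R) :
  mu.-integrable setT (EFin \o f) -> mu.-integrable setT (EFin \o g) ->
  mu.-integrable setT (EFin \o h) ->
  \int[mu]_x `|f x - h x| <= \int[mu]_x `|f x - g x| + \int[mu]_x `|g x - h x|.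
Proof.
move=> fi gi hi; have int_dist := fun u v ui vi => integrable_norm (@integrable_sub u v ui vi).
rewrite -RintegralD//; [|exact: int_dist..].
apply: le_Rintegral => //; first exact: int_dist.
  rewrite (_ : _ \o _ = (EFin \o (fun x => `|f x - g x|)%R) \+
    (EFin \o (fun x => `|g x - h x|)%R))%E//.
  by apply: integrableD => //; exact: int_dist.
by move=> x _; exact: ler_distD.
Qed.

(** The minimizer is chosen as a function of the data [e] alone, so the resulting estimator cannot
    depend on the unknown density. *)
Lemma exists_minimizer (I : finType) (E : Type) (i0 : I) (D : I -> E -> R) :
  exists s : E -> I, forall e i, D (s e) e <= D i e.
Proof.
suff /choice[s hs] : forall e, exists j, forall i, D j e <= D i e by exists s.
by move=> e; case: (@Order.TotalTheory.arg_minP _ _ _ i0 predT (D ^~ e)) => // j _ h;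
  exists j => i; exact: h.
Qed.

Section yatracos.
Variables (I : finType) (q : I -> T -> R).
Hypothesis qi : forall i, mu.-integrable setT (EFin \o q i).
Hypothesis q1 : forall i, \int[mu]_x q i x = 1.

Definition yatracos_set (a : I * I) : set T := [set x | q a.2 x < q a.1 x].

Lemma measurable_yatracos_set a : measurable (yatracos_set a).
Proof.
have mq i : measurable_fun setT (q i) by exact/measurable_EFinP/(measurable_int mu).
rewrite -[X in measurable X]setTI.
exact: (measurable_fun_ltr (mq _) (mq _) measurableT (Y := [set true])).
Qed.

(** The minimum-distance criterion. The vector [e] will hold the empirical frequencies of the
    Yatracos sets. *)
Definition yatracos_discrepancy (i : I) (e : I * I -> R) : R :=
  \big[Num.max/0]_(a : I * I) `|\int[mu]_(x in yatracos_set a) q i x - e a|.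

(** By Scheffe's identity the distance is twice the gap on the set indexed by [(i, j)], and that gap
    is compared with [e (i, j)] on both sides. *)
Lemma yatracos_L1 (i j : I) (e : I * I -> R) :
  \int[mu]_x `|q i x - q j x| <=
  2 * (yatracos_discrepancy i e + yatracos_discrepancy j e).
Proof.
have le_disc l a : `|\int[mu]_(x in yatracos_set a) q l x - e a| <= yatracos_discrepancy l e.
  exact: le_bigmax.
have fi : mu.-integrable setT (EFin \o (fun x => q i x - q j x)).
  exact: integrable_sub.
rewrite scheffe_eq//; last by rewrite RintegralB// !q1 subrr.
rewrite (_ : [set x | _] = yatracos_set (i, j)); last first.
  by apply/seteqP; split => x; rewrite /yatracos_set/= subr_gt0.
have mA := measurable_yatracos_set (i, j).
rewrite RintegralB//; [|exact: integrableT..].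
have := le_disc i (i, j); have := le_disc j (i, j).
by rewrite !ler_norml => /andP[? ?] /andP[? ?]; lra.
Qed.

(** Go from [q s] to [p] through [q i]. The first leg costs at most four discrepancies of [i], by
    minimality of [s], and twice that discrepancy is at most the distance from [q i] to [p] plus
    [2 * t]. *)
Lemma yatracos_selection (p : T -> R) (e : I * I -> R) (t : R) (s : I) :
  mu.-integrable setT (EFin \o p) -> \int[mu]_x p x = 1 ->
  (forall a, `|e a - \int[mu]_(x in yatracos_set a) p x| <= t) ->
  (forall i, yatracos_discrepancy s e <= yatracos_discrepancy i e) ->
  forall i, \int[mu]_x `|q s x - p x| <= 3 * (\int[mu]_x `|q i x - p x|) + 4 * t.
Proof.
move=> pint p1 et smin i.
have Di : 2 * yatracos_discrepancy i e <= \int[mu]_x `|q i x - p x| + 2 * t.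
  (* Nonnegativity of [t] handles the base value [0] of the maximum; any pair of indices would
     witness it. *)
  have t0 : 0 <= t by apply: le_trans (et (i, i)); exact: normr_ge0.
  rewrite -ler_pdivlMl//; apply: bigmax_le => [|a _].
    rewrite mulr_ge0 ?invr_ge0// addr_ge0 ?mulr_ge0//.
    exact: Rintegral_ge0.
  have mA := measurable_yatracos_set a.
  have := scheffe_ub mA (integrable_sub (qi i) pint).
  rewrite RintegralB// q1 p1 subrr => /(_ erefl).
  rewrite RintegralB//; [|exact: integrableT..].
  have := et a.
  move: (\int[mu]_(x in _) q i x) (\int[mu]_(x in _) p x) => u v.
  have : `|u - e a| <= `|u - v| + `|e a - v|.
    by rewrite (distrC (e a)); exact: ler_distD.
  lra.
have tri := Rintegral_dist_triangle (qi s) (qi i) pint.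
have := yatracos_L1 s i e; have := smin i; lra.
Qed.

End yatracos.
End scheffe.

(** * The minimum-distance estimator: measurability and deviation bound *)

Lemma measurable_finite_preimage (disp : measure_display) (T : measurableType disp)
    (C : finType) (phi : T -> C) :
  (forall c, measurable [set x | phi x = c]) ->
  forall B : set C, measurable [set x | B (phi x)].
Proof.
move=> mphi B.
rewrite (_ : [set x | B (phi x)] = \bigcup_(c in B) [set x | phi x = c]).
  by apply: fin_bigcup_measurable => // ; exact: finite_finset.
by apply/seteqP; split => [x Bx|x [c Bc /= ->]//]; exists (phi x).
Qed.

Section estimator.
Context {disp : measure_display} {T : measurableType disp} {R : realType}.

(** The selection can only fail if one of the [#|I| ^ 2] Yatracos sets has an empirical frequency
    more than [t] away from its probability. The selector is fixed before [p], [P] and [t]. *)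
Lemma min_distance_estimator (mu : {measure set T -> \bar R})
    (I : finType) (i0 : I) (q : I -> T -> R) (n : nat) :
  (forall i, mu.-integrable setT (EFin \o q i)) ->
  (forall i, \int[mu]_x q i x = 1) ->
  exists2 s : n.-tuple T -> I,
    forall B : set I, measurable [set X | B (s X)] &
    forall (p : T -> R) (P : probability T R) (t : R),
      mu.-integrable setT (EFin \o p) -> \int[mu]_x p x = 1 ->
      (forall A, measurable A -> fine (P A) = \int[mu]_(x in A) p x) ->
      (0 < n)%N -> 0 < t <= 2 ->
      (power_measure P n [set X | exists i,
         3 * (\int[mu]_x `|q i x - p x|) + 4 * t < \int[mu]_x `|q (s X) x - p x|]%R
       <= (2 * (#|I| ^ 2)%:R * expR (- (t ^+ 2 / 8) * n%:R))%:E)%E.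
Proof.
move=> qi q1.
have [s0 s0P] := exists_minimizer i0 (yatracos_discrepancy mu q).
pose A := yatracos_set q.
have mA a : measurable (A a) by exact: (measurable_yatracos_set qi).
(* The sample enters only through the finite table telling which observation lies in which set;
   hence every event about the selected index is measurable, whatever the minimizer. *)
pose phi (X : n.-tuple T) : {ffun (I * I) * 'I_n -> bool} :=
  [ffun a => tnth X a.2 \in A a.1].
pose emp (b : {ffun (I * I) * 'I_n -> bool}) a : R :=
  n%:R^-1 * \sum_(j < n) (b (a, j))%:R.
have mphi : forall c, measurable [set X | phi X = c].
  move=> c; rewrite (_ : [set X | _] = \bigcap_(a in [set: (I * I) * 'I_n])
      [set X | (tnth X a.2 \in A a.1) = c a]).
    apply: fin_bigcap_measurable => [|[a j] _]; first exact: finite_finset.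
    rewrite [X in measurable X](_ : _ =
      (fun X : n.-tuple T => tnth X j) @^-1` (if c (a, j) then A a else ~` A a)).
      rewrite -[X in measurable X]setTI; apply: measurable_tnth => //.
      by case: ifP => // _; exact: measurableC.
    apply/seteqP; split => X /=.
      by move=> <-; case: ifPn => [/set_mem//|/negP h] hX; apply: h; exact/mem_set.
    by case: (c _) => [/mem_set|] // h; apply/negbTE/negP => /set_mem.
  apply/seteqP; split => [X <- a _|X h]; first by rewrite /= ffunE.
  by apply/ffunP => a; rewrite ffunE; exact: h.
exists (fun X => s0 (emp (phi X))).
  by move=> B; exact: (measurable_finite_preimage mphi (B \o s0 \o emp)).
move=> p P t pint p1 Pp n0 t02.
have -> : (#|I| ^ 2 = #|{: I * I}|)%N by rewrite card_prod -mulnn.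
apply: (uniform_deviation (A := A)) => //.
  exact: (measurable_finite_preimage mphi [set b | exists i,
    3 * (\int[mu]_x `|q i x - p x|) + 4 * t < \int[mu]_x `|q (s0 (emp b)) x - p x|]).
(* By contraposition: if no set deviates, the selection inequality holds for every [i]. *)
move=> X [i hi]; apply: contrapT => /forallNP h.
move: hi; apply/negP; rewrite -leNgt.
apply: yatracos_selection => // a.
have /negP := h a; rewrite -leNgt Pp// sumrB sumr_const card_ord => {}h.
have n0R : 0 < n%:R :> R by rewrite ltr0n.
rewrite -(ler_pM2l n0R) -[X in X * `|_|]gtr0_norm// -normrM mulrBr /emp mulrA.
rewrite divff ?gt_eqF// mul1r mulr_natl.
by under eq_bigr do rewrite ffunE -indicE.
Qed.

End estimator.

(** * Step functions and mixtures of their tensor products *)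

Section step_functions.
Context {R : realType}.

(** The weights are unconstrained, so that weights such as [|w i - w' i|] are allowed when
    differences are dominated. *)
Definition step (b : nat) (w : 'I_b -> R) (x : measurableTypeR R) : R :=
  \sum_i w i * hist1_bin i x.

Lemma hist1_bin_ge0 (b : nat) (i : 'I_b) (x : R) : 0 <= hist1_bin i x.
Proof. by rewrite /hist1_bin mulr_ge0// indicE ler0n. Qed.

Lemma step_ge0 (b : nat) (w : 'I_b -> R) x : (forall i, 0 <= w i) -> 0 <= step w x.
Proof. by move=> w0; apply: sumr_ge0 => i _; rewrite mulr_ge0// hist1_bin_ge0. Qed.

Lemma measurable_hist1_bin (b : nat) (i : 'I_b) :
  measurable_fun setT (hist1_bin i : measurableTypeR R -> R).
Proof.
by apply: measurable_funM => //; apply: measurable_indic; exact: measurable_itv.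
Qed.

Lemma measurable_step (b : nat) (w : 'I_b -> R) : measurable_fun setT (step w).
Proof.
by apply: measurable_sum => i; apply: measurable_funM => //; exact: measurable_hist1_bin.
Qed.

Lemma integral_hist1_bin (b : nat) (i : 'I_b) :
  (\int[lebesgue_measure]_x (hist1_bin i x : R)%:E = 1)%E.
Proof.
have b0 : (0 < b)%N by apply: leq_ltn_trans (ltn_ord i).
rewrite /hist1_bin; under eq_integral do rewrite EFinM.
rewrite ge0_integralZl//; first last.
- apply/measurable_EFinP; apply: measurable_indic; exact: measurable_itv.
rewrite integral_indic//= setIT lebesgue_measure_itv/= lte_fin.
rewrite ltr_pM2r ?invr_gt0 ?ltr0n// ltr_nat ltnSn -EFinD -EFinM.
by congr (_%:E); rewrite -natr1; field; rewrite pnatr_eq0 -lt0n.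
Qed.

Lemma integral_step (b : nat) (w : 'I_b -> R) : (forall i, 0 <= w i) ->
  (\int[lebesgue_measure]_x (step w x)%:E = (\sum_i w i)%:E)%E.
Proof.
move=> w0; rewrite /step; under eq_integral do rewrite -sumEFin.
have mh i : measurable_fun setT (hist1_bin (R := R) (b := b) i : measurableTypeR R -> R).
  exact: measurable_hist1_bin.
rewrite ge0_integral_sum//; first last.
- by move=> i x _; rewrite lee_fin mulr_ge0// hist1_bin_ge0.
- by move=> i; apply/measurable_EFinP; apply: measurable_funM.
rewrite -sumEFin; apply: eq_bigr => i _.
under eq_integral do rewrite EFinM.
rewrite ge0_integralZl ?lee_fin//; first by rewrite integral_hist1_bin mule1.
- exact/measurable_EFinP.
- by move=> x _; rewrite lee_fin hist1_bin_ge0.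
Qed.

Lemma step_outside (b : nat) (w : 'I_b -> R) (x : R) : ~ (0 <= x < 1) -> step w x = 0.
Proof.
move=> hx; rewrite /step big1// => i _; rewrite /hist1_bin indicE memNset ?mulr0//=.
have b0 : (0 < b)%N by apply: leq_ltn_trans (ltn_ord i).
rewrite in_itv/= => /andP[h1 h2]; apply: hx; apply/andP; split.
  by apply: le_trans h1; rewrite divr_ge0.
by apply: lt_le_trans h2 _; rewrite ler_pdivrMr ?ltr0n// mul1r ler_nat.
Qed.

Lemma normr_step_sub (b : nat) (w w' : 'I_b -> R) x :
  `|step w x - step w' x| <= step (fun i => `|w i - w' i|) x.
Proof.
rewrite /step -sumrB (le_trans (ler_norm_sum _ _ _))// ler_sum// => i _.
by rewrite -mulrBl normrM (ger0_norm (hist1_bin_ge0 i x)).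
Qed.

(** Common form of both histogram classes: [K] is ['I_k] for multi-view and the set of multi-indices
    for Tucker histograms. The weights are again unconstrained. *)
Definition mixture (d b : nat) (K : finType) (c : K -> R)
    (w : K -> 'I_d -> 'I_b -> R) (x : Rvec R d) : R :=
  \sum_k c k * \prod_j step (w k j) (tnth x j).

Variables (d b : nat) (K : finType) (c : K -> R) (w : K -> 'I_d -> 'I_b -> R).

Lemma measurable_mixture : measurable_fun setT (mixture c w).
Proof.
apply: measurable_sum => k; apply: measurable_funM => //.
apply: measurable_prod => j _.
by apply: measurableT_comp (measurable_step _) _; exact: measurable_tnth.
Qed.

Lemma mixture_ge0 x : (forall k, 0 <= c k) -> (forall k j i, 0 <= w k j i) ->
  0 <= mixture c w x.
Proof.
move=> c0 w0; apply: sumr_ge0 => k _; rewrite mulr_ge0// prodr_ge0// => j _.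
exact: step_ge0.
Qed.

(** Every bin integrates to one, so integrals reduce to sums of weights. This gives both the
    normalization of densities and the [L1] estimates between mixtures. *)
Lemma integral_mixture : (forall k, 0 <= c k) -> (forall k j i, 0 <= w k j i) ->
  (\int[lebesgue_vec d]_x (mixture c w x)%:E =
   (\sum_k c k * \prod_j \sum_i w k j i)%:E)%E.
Proof.
move=> c0 w0; rewrite /mixture; under eq_integral do rewrite -sumEFin.
have mp k : measurable_fun setT (fun x : Rvec R d => \prod_j step (w k j) (tnth x j)).
  apply: measurable_prod => j _.
  by apply: measurableT_comp (measurable_step _) _; exact: measurable_tnth.
have p0 k (x : Rvec R d) : 0 <= \prod_j step (w k j) (tnth x j).
  by apply: prodr_ge0 => j _; exact: step_ge0.
rewrite ge0_integral_sum//; first last.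
- by move=> k x _; rewrite lee_fin mulr_ge0.
- by move=> k; apply/measurable_EFinP; exact: measurable_funM.
rewrite -sumEFin; apply: eq_bigr => k _.
under eq_integral do rewrite EFinM.
rewrite ge0_integralZl ?lee_fin//; first last.
- by move=> x _; rewrite lee_fin.
- exact/measurable_EFinP.
rewrite EFinM; congr (_ * _)%E.
rewrite /lebesgue_vec (@integral_power_measure_prod _ _ _ lebesgue_measure d
  (fun j => step (w k j)))//; first last.
- by move=> j x; exact: step_ge0.
- by move=> j; exact: measurable_step.
by rewrite -prodEFin; apply: eq_bigr => j _; rewrite integral_step.
Qed.

End step_functions.

(** Telescoping changes one factor at a time, and each untouched factor is at most [f j + g j]. The
    bound is again a sum of products, so for step functions it is a mixture. *)
Lemma ler_norm_prodB (R : realType) (I : finType) (f g : I -> R) :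
  (forall i, 0 <= f i) -> (forall i, 0 <= g i) ->
  `|\prod_i f i - \prod_i g i| <=
  \sum_i \prod_j (if j == i then `|f j - g j| else f j + g j).
Proof.
move=> f0 g0.
suff H (s : seq I) : uniq s -> `|\prod_(i <- s) f i - \prod_(i <- s) g i| <=
  \sum_(i <- s) \prod_(j <- s) (if j == i then `|f j - g j| else f j + g j).
  by apply: H; exact: index_enum_uniq.
elim: s => [|k s IH] /=; first by rewrite !big_nil subrr normr0.
move=> /andP[ks us]; rewrite !big_cons eqxx.
have -> : f k * \prod_(j <- s) f j - g k * \prod_(j <- s) g j =
  (f k - g k) * \prod_(j <- s) f j + g k * (\prod_(j <- s) f j - \prod_(j <- s) g j).
  by ring.
apply: (le_trans (ler_normD _ _)); rewrite !normrM; apply: lerD.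
  rewrite ler_wpM2l// ger0_norm ?prodr_ge0//.
  rewrite big_seq [leRHS]big_seq; apply: ler_prod => j js.
  rewrite f0/= ifF ?lerDl//; apply/negbTE/eqP => jk.
  by rewrite jk (negbTE ks) in js.
rewrite (ger0_norm (g0 k)); apply: (le_trans (ler_wpM2l (g0 k) (IH us))).
rewrite mulr_sumr big_seq [leRHS]big_seq; apply: ler_sum => i is_.
rewrite big_cons ifF; last first.
  by apply/negbTE/eqP => ki; rewrite ki is_ in ks.
rewrite ler_wpM2r ?lerDr//; apply: prodr_ge0 => j _.
by case: ifP => // _; rewrite addr_ge0.
Qed.

(** * [L1] distance between mixtures, and grids on parameter sets *)

Section mixture_geometry.
Context {R : realType}.

Lemma integrable_density (d : nat) (p : Rvec R d -> R) : densities d p ->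
  (lebesgue_vec d).-integrable setT (EFin \o p).
Proof.
case=> mp p0 _ p1; apply/integrableP; split; first exact/measurable_EFinP.
under eq_integral => x _ do rewrite /= ger0_norm//.
by rewrite p1 ltry.
Qed.

Lemma L1distE (d : nat) (f g : Rvec R d -> R) :
  (L1dist f g = \int[lebesgue_vec d]_x `|f x - g x|%:E)%E.
Proof. by rewrite /L1dist Lnorm1; under eq_integral do rewrite /=. Qed.

Lemma L1dist_Rintegral (d : nat) (f g : Rvec R d -> R) :
  densities d f -> densities d g ->
  L1dist f g = (\int[lebesgue_vec d]_x `|f x - g x|)%:E.
Proof.
move=> df dg; rewrite L1distE /Rintegral fineK//; apply: integrable_fin_num => //.
have fg : (lebesgue_vec d).-integrable setT (EFin \o (fun x => f x - g x)).
  by apply: integrable_sub; exact: integrable_density.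
exact: integrable_norm fg.
Qed.

Lemma mixture_density (d b : nat) (K : finType) (c : K -> R)
    (w : K -> 'I_d -> 'I_b -> R) :
  prob_weights c -> (forall k j, prob_weights (w k j)) -> densities d (mixture c w).
Proof.
move=> [c0 c1] pw; split.
- exact: measurable_mixture.
- by move=> x; apply: mixture_ge0 => // k j i; case: (pw k j).
- move=> x /existsNP[j xj]; rewrite /mixture big1// => k _.
  by rewrite (bigD1 j)//= step_outside// mul0r mulr0.
- rewrite integral_mixture//; last by move=> k j i; case: (pw k j).
  rewrite -[in RHS]c1; congr (_%:E); apply: eq_bigr => k _.
  by rewrite big1 ?mulr1// => j _; case: (pw k j).
Qed.

(** The difference is dominated by two mixtures. The first carries the change of the outer weights.
    The second is indexed by a component and the telescoped coordinate, which contributes at most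
    [eta], while each other coordinate contributes [2]. *)
Lemma L1dist_mixture (d b : nat) (J : finType) (W W' : J -> R)
    (a a' : J -> 'I_d -> 'I_b -> R) (eta : R) :
  prob_weights W -> prob_weights W' ->
  (forall k j, prob_weights (a k j)) -> (forall k j, prob_weights (a' k j)) ->
  (forall k j, \sum_i `|a k j i - a' k j i| <= eta) ->
  (L1dist (mixture W a) (mixture W' a') <=
   (\sum_k `|W k - W' k| + d%:R * (eta * 2 ^+ d.-1))%:E)%E.
Proof.
move=> [W0 W1] [W'0 W'1] pa pa' aa'.
have a0 k j i : 0 <= a k j i by case: (pa k j).
have a'0 k j i : 0 <= a' k j i by case: (pa' k j).
pose c1 k := `|W k - W' k|.
pose c2 (k : J * 'I_d) := W' k.1.
pose w2 (k : J * 'I_d) (j : 'I_d) (i : 'I_b) :=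
  if j == k.2 then `|a k.1 j i - a' k.1 j i| else a k.1 j i + a' k.1 j i.
have w20 k j i : 0 <= w2 k j i by rewrite /w2; case: ifP => // _; rewrite addr_ge0.
have c10 k : 0 <= c1 k by rewrite /c1.
have c20 k : 0 <= c2 k by exact: W'0.
have ptw x : `|mixture W a x - mixture W' a' x| <= mixture c1 a x + mixture c2 w2 x.
  have -> : mixture c2 w2 x =
      \sum_k \sum_i W' k * \prod_j step (w2 (k, i) j) (tnth x j).
    by rewrite pair_bigA.
  rewrite /mixture -sumrB -big_split/= (le_trans (ler_norm_sum _ _ _))// ler_sum// => k _.
  rewrite [X in `|X|](_ : _ = (W k - W' k) * \prod_j step (a k j) (tnth x j) +
    W' k * (\prod_j step (a k j) (tnth x j) - \prod_j step (a' k j) (tnth x j))); last first.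
    by ring.
  rewrite (le_trans (ler_normD _ _))// !normrM lerD//.
    by rewrite ler_wpM2l// ger0_norm// prodr_ge0// => j _; exact: step_ge0.
  rewrite (ger0_norm (W'0 k)) -mulr_sumr ler_wpM2l//.
  apply: (le_trans (ler_norm_prodB _ _)); [by move=> j; exact: step_ge0..|].
  apply: ler_sum => i _; apply: ler_prod => j _; rewrite /w2/=; case: ifP => _.
    by rewrite normr_ge0; exact: normr_step_sub.
  rewrite addr_ge0 ?step_ge0//= /step -big_split/= ler_sum// => l _.
  by rewrite mulrDl.
have m1 := measurable_mixture c1 a; have m2 := measurable_mixture c2 w2.
rewrite L1distE.
apply: (@le_trans _ _ (\int[lebesgue_vec d]_x
    ((mixture c1 a x)%:E + (mixture c2 w2 x)%:E))%E).
  apply: ge0_le_integral => //.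
  - apply/measurable_EFinP; apply: measurableT_comp => //.
    by apply: measurable_funB; exact: measurable_mixture.
  - by apply: emeasurable_funD; exact/measurable_EFinP.
  - by move=> x _; rewrite -EFinD lee_fin.
rewrite ge0_integralD//; first last.
- exact/measurable_EFinP.
- by move=> x _; rewrite lee_fin mixture_ge0.
- exact/measurable_EFinP.
- by move=> x _; rewrite lee_fin mixture_ge0.
rewrite !integral_mixture// -EFinD lee_fin lerD//.
  rewrite ler_sum// => k _; rewrite big1 ?mulr1// => j _; by case: (pa k j).
apply: (@le_trans _ _ (\sum_(k : J * 'I_d) c2 k * (eta * 2 ^+ d.-1))).
  apply: ler_sum => -[k i] _; rewrite ler_wpM2l// (bigD1 i)//=.
  apply: ler_pM.
  - by apply: sumr_ge0.
  - by apply: prodr_ge0 => j _; apply: sumr_ge0.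
  - by rewrite /w2 eqxx; exact: aa'.
  have -> : 2 ^+ d.-1 = \prod_(j < d | j != i) 2 :> R.
    rewrite prodr_const; congr (_ ^+ _).
    by rewrite -[in LHS](card_ord d) -(cardC1 i); apply: eq_card => j; rewrite !inE.
  apply: ler_prod => j ji; rewrite sumr_ge0//= /w2/= (negbTE ji) big_split/=.
  by case: (pa k j) => _ ->; case: (pa' k j) => _ ->.
rewrite -mulr_suml.
have -> // : \sum_(k : J * 'I_d) c2 k = d%:R.
rewrite /c2 -(pair_bigA _ (fun k (i : 'I_d) => W' k))/=.
under eq_bigr do rewrite sumr_const card_ord -mulr_natr.
by rewrite -mulr_suml W'1 mul1r.
Qed.

(* A representative of each cell of the grid keeps the net inside [S]. *)
Lemma grid_net (Th : finType) (S : set (Th -> R)) (M : nat) : (0 < M)%N -> S !=set0 ->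
  (forall th, S th -> forall k, 0 <= th k <= 1) ->
  exists2 c : {ffun Th -> 'I_M.+1} -> Th -> R, forall i, S (c i) &
    forall th, S th -> exists i, forall k, `|th k - c i k| <= M%:R^-1.
Proof.
move=> M0 [th0 S0] S01.
have M0R : 0 < M%:R :> R by rewrite ltr0n.
(* There are [M.+1] levels because a coordinate may equal [1]; [inord] is exact on the points of
   [S]. *)
pose cell (th : Th -> R) : {ffun Th -> 'I_M.+1} :=
  [ffun k => inord (Num.truncn (M%:R * th k))].
(* Cells that miss [S] receive the default point [th0]. *)
have /choice[c hc] : forall i, exists th, S th /\
    ((exists2 th', S th' & cell th' = i) -> cell th = i).
  move=> i; have [[th' Sth' <-]|h] := pselect (exists2 th', S th' & cell th' = i).
    by exists th'.
  by exists th0.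
exists c; first by move=> i; case: (hc i).
move=> th Sth; exists (cell th) => k.
have [Sc /(_ (ex_intro2 _ _ th Sth erefl))] := hc (cell th).
move/ffunP => /(_ k); rewrite !ffunE.
have trM (u : R) : 0 <= u <= 1 -> (Num.truncn (M%:R * u) < M.+1)%N.
  move=> /andP[u0 u1]; rewrite ltnS -(ler_nat R).
  by rewrite (le_trans (y := M%:R * u))// ?truncn_le ?mulr_ge0// ?ler_piMr// ltW.
move/(congr1 val); rewrite /= !inordK ?trM ?S01// => E.
have h (u : R) : 0 <= u <= 1 -> (Num.truncn (M%:R * u))%:R <= M%:R * u < (Num.truncn (M%:R * u)).+1%:R.
  by move=> /andP[u0 _]; apply: truncn_itv; rewrite mulr_ge0// ltW.
(* Two numbers with the same integer part after scaling by [M] differ by at most [1 / M]. *)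
have /andP[h1 h2] := h _ (S01 _ Sth k).
have /andP[] := h _ (S01 _ Sc k); rewrite E => h3 h4.
rewrite -(ler_pM2l M0R) divff ?gt_eqF// -[X in X * `|_|]gtr0_norm// -normrM mulrBr.
by move: h2 h4; rewrite -!natr1 ler_norml => h2 h4; lra.
Qed.

End mixture_geometry.

(** * Finite nets of the histogram classes *)

Section histogram_net.
Context {R : realType}.

(** The label [lab k j] names the factor used by component [k] in mode [j]. Sharing factors keeps
    the number of parameters at [#|J| + #|L| * b], linear in [b] with few factors even for Tucker
    histograms. *)
Definition mixture_class (d b : nat) (J L : finType) (lab : J -> 'I_d -> L) :
    set (Rvec R d -> R) :=
  [set q | exists W : J -> R, exists a : L -> 'I_b -> R,
    [/\ prob_weights W, (forall l, prob_weights (a l)) &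
        q = mixture W (fun k j => a (lab k j))]].

Lemma multiview_hist_mixture (d b k : nat) :
  multiview_hist d b k = @mixture_class d b 'I_k ('I_k * 'I_d)%type pair.
Proof.
apply/seteqP; split => q.
  move=> [W [f [pW hf ->]]].
  have /choice[a ha] : forall l : 'I_k * 'I_d, exists w : 'I_b -> R,
      prob_weights w /\ f l.1 l.2 = step w.
    by move=> [i j]; have [w pw fw] := hf i j; exists w.
  exists W, a; split => //; first by move=> l; case: (ha l).
  apply/funext => x; apply: eq_bigr => i _; congr (_ * _); apply: eq_bigr => j _.
  by have [_ /= ->] := ha (i, j).
move=> [W [a [pW pa ->]]].
by exists W, (fun i j => step (a (i, j))); split => // i j; exists (a (i, j)).
Qed.

Lemma tucker_hist_mixture (d b k : nat) :
  tucker_hist d b k = @mixture_class d b {ffun 'I_d -> 'I_k} ('I_d * 'I_k)%type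
                        (fun S j => (j, S j)).
Proof.
apply/seteqP; split => q.
  move=> [W [f [pW hf ->]]].
  have /choice[a ha] : forall l : 'I_d * 'I_k, exists w : 'I_b -> R,
      prob_weights w /\ f l.1 l.2 = step w.
    by move=> [i j]; have [w pw fw] := hf i j; exists w.
  exists W, a; split => //; first by move=> l; case: (ha l).
  apply/funext => x; apply: eq_bigr => S _; congr (_ * _); apply: eq_bigr => j _.
  by have [_ /= ->] := ha (j, S j).
move=> [W [a [pW pa ->]]].
by exists W, (fun i j => step (a (i, j))); split => // i j; exists (a (i, j)).
Qed.

Lemma prob_weights_itv01 (I : finType) (w : I -> R) : prob_weights w ->
  forall i, 0 <= w i <= 1.
Proof.
move=> [w0 w1] i; rewrite w0/= -w1 (bigD1 i)//= lerDl.
by apply: sumr_ge0.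
Qed.

Lemma prob_weights_delta (I : finType) (i0 : I) :
  prob_weights (fun i : I => (i == i0)%:R : R).
Proof.
split; first by move=> i; rewrite ler0n.
by rewrite (bigD1 i0)//= eqxx big1 ?addr0// => i /negbTE ->.
Qed.

(** All weights form one point of a unit cube, discretized with mesh [1 / M]. The error is at most
    [(#|J| + d * b * 2 ^ d) / M], and the choice [M = m * b * (#|J| + d * 2 ^ d)] brings it below
    [1 / m]. *)
Lemma mixture_class_net (d b m : nat) (J L : finType) (lab : J -> 'I_d -> L) :
  (0 < b)%N -> (0 < m)%N -> (0 < #|J|)%N ->
  exists (I : finType) (q : I -> Rvec R d -> R),
    [/\ (0 < #|I| <= (m * b * (#|J| + d * 2 ^ d)).+1 ^ (#|J| + #|L| * b))%N,
        forall i, mixture_class b lab (q i) &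
        forall g, mixture_class b lab g ->
          exists i, (L1dist (q i) g <= (m%:R^-1)%:E)%E].
Proof.
move=> b0 m0 J0; set M := (m * b * _)%N.
have M0 : (0 < M)%N by rewrite !muln_gt0 b0 m0 addn_gt0 J0.
have /card_gt0P[j0 _] := J0.
pose Th := (J + L * 'I_b)%type.
pose S : set (Th -> R) := [set th : Th -> R | prob_weights (fun j => th (inl j)) /\
  forall l, prob_weights (fun i => th (inr (l, i)))].
have SN0 : S !=set0.
  exists (fun t => match t with inl j => (j == j0)%:R
                              | inr li => (li.2 == Ordinal b0)%:R end).
  by split => [|l]; exact: prob_weights_delta.
have S01 (th : Th -> R) : S th -> forall k, 0 <= th k <= 1.
  move=> [h1 h2] [j|[l i]]; first exact: (prob_weights_itv01 h1).
  exact: (prob_weights_itv01 (h2 l)).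
have [c Sc hc] := grid_net M0 SN0 S01.
pose mix (th : Th -> R) : Rvec R d -> R :=
  mixture (th \o inl) (fun k j i => th (inr (lab k j, i))).
exists {ffun Th -> 'I_M.+1}, (mix \o c); split.
- by rewrite card_ffun card_ord card_sum card_prod card_ord expn_gt0/=.
- move=> i; have [h1 h2] := Sc i.
  by exists (c i \o inl), (fun l i' => c i (inr (l, i'))); split.
move=> g [W [a [pW pa ->]]].
pose th : Th -> R := fun t => match t with inl j => W j | inr li => a li.1 li.2 end.
have Sth : S th by split.
have [i hi] := hc th Sth; exists i.
have [h1 h2] := Sc i.
have M0R : 0 < M%:R :> R by rewrite ltr0n.
apply: le_trans (L1dist_mixture (eta := b%:R / M%:R) h1 pW _ _ _) _.
- by move=> k j; exact: h2.
- by move=> k j; exact: pa.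
- move=> k j; apply: (@le_trans _ _ (\sum_(i' < b) M%:R^-1)).
    by apply: ler_sum => i' _; rewrite distrC; exact: (hi (inr (lab k j, i'))).
  by rewrite sumr_const card_ord mulr_natl.
(* A factor has [b] weights, each off by at most [1 / M], whence [eta = b / M]; the power [d.-1] is
   relaxed to [d]. *)
rewrite lee_fin; apply: (@le_trans _ _ (#|J|%:R / M%:R + d%:R * (b%:R / M%:R * 2 ^+ d))).
  apply: lerD.
    apply: (@le_trans _ _ (\sum_(k : J) M%:R^-1)).
      by apply: ler_sum => k _; rewrite distrC; exact: (hi (inl k)).
    by rewrite sumr_const mulr_natl.
  do 2 rewrite ler_wpM2l ?divr_ge0//.
  by rewrite ler_eXn2l ?ltr1n// leq_pred.
rewrite [leLHS](_ : _ = (#|J|%:R + d%:R * b%:R * 2 ^+ d) / M%:R); last by ring.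
rewrite ler_pdivrMr// ler_pdivlMl ?ltr0n//.
rewrite -natrX -!natrM -natrD -natrM ler_nat /M -[in leqRHS]mulnA leq_mul2l.
apply/orP; right; rewrite mulnDr leq_add//; first by rewrite leq_pmull.
by rewrite -mulnA mulnCA.
Qed.

(** One bound serves both classes, since [k + k ^ d] dominates either number of components; the
    class may thus change with the parameters. The accuracy is taken to be [1 / k]. *)
Lemma hist_net (d b k : nat) (Q : set (Rvec R d -> R)) :
  (0 < b)%N -> (0 < k)%N ->
  Q = multiview_hist d b k \/ Q = tucker_hist d b k ->
  exists (I : finType) (q : I -> Rvec R d -> R),
    [/\ (0 < #|I| <= ((k * (k + k ^ d + d * 2 ^ d)).+1 * b)
                       ^ ((k + k ^ d + k * d) * b))%N,
        forall i, Q (q i), Q `<=` densities d &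
        forall g, Q g -> exists i, (L1dist (q i) g <= (k%:R^-1)%:E)%E].
Proof.
move=> b0 k0 hQ.
suff H (J L : finType) (lab : J -> 'I_d -> L) : (0 < #|J| <= k + k ^ d)%N ->
    (#|L| <= k * d)%N -> Q = mixture_class b lab ->
  exists (I : finType) (q : I -> Rvec R d -> R),
    [/\ (0 < #|I| <= ((k * (k + k ^ d + d * 2 ^ d)).+1 * b)
                       ^ ((k + k ^ d + k * d) * b))%N,
        forall i, Q (q i), Q `<=` densities d &
        forall g, Q g -> exists i, (L1dist (q i) g <= (k%:R^-1)%:E)%E].
  case: hQ => hQ.
    apply: (H _ _ _ _ _ (etrans hQ (multiview_hist_mixture d b k))).
      by rewrite card_ord k0 leq_addr.
    by rewrite card_prod !card_ord.
  apply: (H _ _ _ _ _ (etrans hQ (tucker_hist_mixture d b k))).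
    by rewrite card_ffun !card_ord expn_gt0 k0 leq_addl.
  by rewrite card_prod !card_ord mulnC.
move=> /andP[J0 hJ] hL ->.
have [I [q [/andP[I0 cI] qQ net]]] := mixture_class_net lab b0 k0 J0.
exists I, q; split => //; last first.
  by move=> _ [W [a [pW pa ->]]]; apply: mixture_density.
rewrite I0/=; apply: (leq_trans cI).
set X := (k + k ^ d + d * 2 ^ d)%N.
have base : ((k * b * (#|J| + d * 2 ^ d)).+1 <= (k * X).+1 * b)%N.
  rewrite mulSn -add1n leq_add// mulnAC leq_mul2r leq_mul2l leq_add2r hJ.
  by rewrite !orbT.
apply: (@leq_trans (((k * X).+1 * b) ^ (#|J| + #|L| * b))).
  by rewrite leq_exp2r// addn_gt0 J0.
rewrite leq_pexp2l ?muln_gt0// mulnDl leq_add//.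
  by rewrite (leq_trans hJ)// leq_pmulr.
by rewrite leq_mul2r hL orbT.
Qed.

End histogram_net.

(** * The probability measure attached to a density *)

Section density_law.
Context {R : realType}.

Lemma density_law_probability (d : nat) (p : Rvec R d -> R) : densities d p ->
  exists2 P : probability (Rvec R d) R, P = density_law p :> (_ -> _) &
    forall A, measurable A -> fine (P A) = \int[lebesgue_vec d]_(x in A) p x.
Proof.
case=> mp p0 _ p1.
have m0 : density_law p set0 = 0%E by rewrite /density_law integral_set0.
have mge0 A : (0 <= density_law p A)%E.
  by apply: integral_ge0 => x _; rewrite lee_fin.
have madd : semi_sigma_additive (density_law p).
  move=> F mF tF mUF; rewrite /density_law ge0_integral_bigcup//=.
  - apply: is_cvg_ereal_nneg_natsum_cond => n _ _.
    by apply: integral_ge0 => x _; rewrite lee_fin.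
  - apply/measurable_EFinP; exact: measurable_funTS.
  - by move=> x _; rewrite lee_fin.
pose isM := isMeasure.Build _ _ _ (density_law p) m0 mge0 madd.
pose M : {measure set _ -> \bar R} := HB.pack (density_law p) isM.
pose isP := Measure_isProbability.Build _ _ _ M p1.
pose P : probability (Rvec R d) R := HB.pack (density_law p) isM isP.
by exists P.
Qed.

End density_law.

(** * The histogram estimator for fixed parameters *)

Section hist_estimator.
Context {R : realType}.

(** Joint measurability: the estimator is a finite sum of indicators in the sample times functions
    of the evaluation point. *)
Lemma finite_estimator (d n : nat) (Q : set (Rvec R d -> R)) (I : finType)
    (q : I -> Rvec R d -> R) (s : n.-tuple (Rvec R d) -> I) :
  (forall i, Q (q i)) -> (forall i, measurable_fun setT (q i)) ->
  (forall B : set I, measurable [set X | B (s X)]) ->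
  estimator Q (fun X => q (s X)).
Proof.
move=> Qq mq ms; split=> [|X]; last exact: Qq.
rewrite (_ : (fun _ => _) = (fun Xx : n.-tuple (Rvec R d) * Rvec R d =>
    \sum_i \1_[set X | [set i] (s X)] Xx.1 * q i Xx.2)).
  apply: measurable_sum => i; apply: measurable_funM.
    by apply: measurableT_comp measurable_fst; exact: measurable_indic.
  by apply: measurableT_comp measurable_snd.
apply/funext => -[X x] /=; rewrite (bigD1 (s X))//= indicE mem_set// mul1r.
rewrite big1 ?addr0// => i iX; rewrite indicE memNset ?mul0r//=.
by move=> /esym /eqP; exact/negP.
Qed.

(** Replacing the best net element by the best element of [Q] costs [3 / k], as the net has accuracy
    [1 / k]; together with [4 * t] this must fit in [eps]. *)
Lemma hist_estimator (d b k n : nat) (Q : set (Rvec R d -> R)) :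
  (0 < b)%N -> (0 < k)%N ->
  Q = multiview_hist d b k \/ Q = tucker_hist d b k ->
  exists2 V : n.-tuple (Rvec R d) -> Rvec R d -> R, estimator Q V &
    forall (p : Rvec R d -> R) (eps t : R), densities d p -> (0 < n)%N ->
      0 < t <= 2 -> 3 / k%:R + 4 * t <= eps ->
      (sample_law n p [set X : n.-tuple (Rvec R d) |
         3%:E * best_approx Q p + eps%:E < L1dist (V X) p] <=
       (2 * ((((k * (k + k ^ d + d * 2 ^ d)).+1 * b)
              ^ ((k + k ^ d + k * d) * b)) ^ 2)%:R *
        expR (- (t ^+ 2 / 8) * n%:R))%:E)%E.
Proof.
move=> b0 k0 hQ.
have [I [q [/andP[I0 cI] Qq Qd net]]] := hist_net b0 k0 hQ.
have /card_gt0P[i0 _] := I0.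
have dq i : densities d (q i) by exact/Qd/Qq.
have iq i : (lebesgue_vec d).-integrable setT (EFin \o q i).
  exact: integrable_density.
have q1 i : \int[lebesgue_vec d]_x q i x = 1.
  by rewrite /Rintegral; case: (dq i) => _ _ _ ->.
have [s ms hs] := min_distance_estimator i0 n iq q1.
exists (fun X => q (s X)).
  by apply: finite_estimator => // i; case: (dq i).
move=> p eps t dp n0 t02 hk.
have [P PE Pp] := density_law_probability dp.
have p1 : \int[lebesgue_vec d]_x p x = 1.
  by rewrite /Rintegral; case: (dp) => _ _ _ ->.
rewrite /sample_law -PE.
have := hs p P t (integrable_density dp) p1 Pp n0 t02.
set G := [set X | _]; set bnd := (_%:R) in |- * => hG.
apply: (@le_trans _ _ (power_measure P n G)).
  apply: le_measure; rewrite ?inE.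
  (* Both events depend on the sample only through the selected index. *)
  - exact: (ms [set i | 3%:E * best_approx Q p + eps%:E < L1dist (q i) p]%E).
  - exact: (ms [set j | exists i, 3 * (\int[lebesgue_vec d]_x `|q i x - p x|) + 4 * t
       < \int[lebesgue_vec d]_x `|q j x - p x|]).
  move=> X /= hX; apply: contrapT => /forallNP hN.
  move: hX; rewrite L1dist_Rintegral//; apply/negP; rewrite -leNgt.
  set x := \int[_]_ _ _ in hN *.
  (* The infimum is bounded below element by element, so no minimizer in [Q] is required. *)
  have hbest : (((x - 3 / k%:R - 4 * t) / 3)%:E <= best_approx Q p)%E.
    apply: le_ereal_inf_tmp => _ [g Qg <-].
    have [i hi] := net g Qg; have dg := Qd g Qg.
    have /negP := hN i; rewrite -leNgt => {}hN.
    rewrite L1dist_Rintegral// lee_fin.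
    have tri : \int[lebesgue_vec d]_x `|q i x - p x| <=
        \int[lebesgue_vec d]_x `|p x - g x| + k%:R^-1.
      rewrite L1dist_Rintegral// lee_fin in hi.
      apply: le_trans (Rintegral_dist_triangle (iq i) (integrable_density dg)
        (integrable_density dp)) _.
      rewrite addrC lerD//; under eq_Rintegral do rewrite distrC.
      by [].
    move: hN tri; move: (\int[_]_ _ _) (\int[_]_ _ _) x => u v y.
    lra.
  apply: (@le_trans _ _ (3%:E * ((x - 3 / k%:R - 4 * t) / 3)%:E + eps%:E)%E).
    by rewrite -EFinM -EFinD lee_fin; lra.
  by rewrite leeD2r// lee_pmul2l.
apply: (le_trans hG); rewrite lee_fin ler_wpM2r ?expR_ge0// ler_wpM2l//.
by rewrite ler_nat leq_exp2r.
Qed.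

End hist_estimator.

(** * Growth of the net size and choice of the rank *)

Section rates.
Context {R : realType}.

(** Here [b >= e] gives [ln b >= 1], hence [ln C + ln b <= (ln C + 1) * ln b]. *)
Lemma hist_net_size_le (C D b : nat) : (0 < C)%N -> expR 1 <= b%:R :> R ->
  (((C * b) ^ (D * b))%N)%:R <=
    expR (D%:R * (ln (C%:R : R) + 1) * (b%:R * ln b%:R)) :> R.
Proof.
move=> C0 hb.
have b0 : 0 < b%:R :> R by apply: lt_le_trans (expR_gt0 1) hb.
have C0R : 0 < C%:R :> R by rewrite ltr0n.
have lb : 1 <= ln (b%:R : R) by rewrite -[leLHS]expRK ler_ln ?posrE ?expR_gt0.
have lC : 0 <= ln (C%:R : R) by rewrite ln_ge0// ler1n.
have Cb0 : 0 < (C * b)%N%:R :> R by rewrite natrM mulr_gt0.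
rewrite natrX -[(C * b)%N%:R]lnK ?posrE// -expRM_natl ler_expR.
rewrite !natrM lnM ?posrE// -!mulrA ler_wpM2l// mulrCA ler_wpM2l//.
nra.
Qed.

(** Take the largest [j <= n] with [K' j <= rho n], where [K'] dominates [K]. Each fixed [j] is
    eventually admissible, so the sequence diverges. *)
Lemma slow_sequence (K : nat -> R) (rho : nat -> R) : rho n @[n --> \oo] --> +oo ->
  exists m : nat -> nat, [/\ forall n, (0 < m n)%N, m n @[n --> \oo] --> \oo &
    \forall n \near \oo, K (m n) <= rho n].
Proof.
move=> rhooo.
pose K' j : R := \sum_(i < j.+1) `|K i|.
have KK' j : K j <= K' j.
  by rewrite /K' big_ord_recr/= (le_trans (ler_norm _))// lerDr sumr_ge0.
pose M n := (\max_(j in [pred j : 'I_n.+1 | (K' j <= rho n)%R]) val j)%N.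
have Mlow c : \forall n \near \oo, (c <= M n)%N.
  have /cvgryPge /(_ (K' c)) h := rhooo.
  near=> n.
  have hn : K' c <= rho n by near: n.
  have cn : (c < n.+1)%N by rewrite ltnS; near: n; exact: nbhs_infty_ge.
  apply: (@leq_bigmax_cond _ _ (fun j : 'I_n.+1 => val j) (Ordinal cn)); rewrite inE.
  exact: hn.
(* The lower cap [1] ensures positivity for every [n] and is eventually inactive. *)
exists (fun n => maxn 1 (M n)); split.
- by move=> n; rewrite leq_max.
- apply/cvgnyPge => c; near=> n; rewrite leq_max; apply/orP; right.
  by near: n; exact: Mlow.
near=> n.
have M1 : (1 <= M n)%N by near: n; exact: Mlow.
rewrite (maxn_idPr M1) (le_trans (KK' _))//.
(* A maximum over no index would be [0]; since [M n >= 1], it is attained at an admissible index. *)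
have : (0 < #|[pred j : 'I_n.+1 | (K' j <= rho n)%R]|)%N.
  apply: contraLR M1; rewrite -eqn0Ngt -leqNgt => /eqP/card0_eq h0.
  rewrite /M big1// => j hj.
  by move: hj; rewrite (h0 j).
move=> /(eq_bigmax_cond (fun j : 'I_n.+1 => val j))[j].
by rewrite inE => hj E; rewrite /M E.
Unshelve. all: by end_near.
Qed.

End rates.

(** * Uniform consistency *)

Lemma densities_nonempty (R : realType) (d : nat) : @densities R d !=set0.
Proof.
(* One component and one bin: the uniform density on the cube. *)
exists (mixture (fun k : 'I_1 => (k == ord0)%:R) (fun _ _ i => (i == ord0 :> 'I_1)%:R)).
by apply: mixture_density => [|_ _]; exact: prob_weights_delta.
Qed.

Theorem corollary2p3 (R : realType)
    (cls : forall d b k : nat, set (Rvec R d -> R))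
    (cls_hist : forall d b k : nat, (0 < d)%N -> (0 < b)%N -> (0 < k)%N ->
       cls d b k = multiview_hist d b k \/ cls d b k = tucker_hist d b k)
    (d : nat) (d_gt0 : (0 < d)%N)
    (b : nat -> nat) (b_gt0 : forall n, (0 < b n)%N)
    (b_oo : b n @[n --> \oo] --> \oo)
    (nb_oo : (n%:R / ((b n)%:R * ln (b n)%:R) : R) @[n --> \oo] --> +oo) :
  exists (k : nat -> nat)
         (V : forall n, n.-tuple (Rvec R d) -> Rvec R d -> R),
    [/\ forall n, (0 < k n)%N,
        k n @[n --> \oo] --> \oo,
        forall n, estimator (cls d (b n) (k n)) (@V n) &
        forall eps : R, 0 < eps ->
          ereal_sup
            [set sample_law n p
                   [set X : n.-tuple (Rvec R d) |
                      (3%:E * best_approx (cls d (b n) (k n)) p + eps%:E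
                         < L1dist (V n X) p)%E]
            | p in densities d] @[n --> \oo] --> 0%E].
Proof.
pose C k := (k * (k + k ^ d + d * 2 ^ d)).+1.
pose D k := (k + k ^ d + k * d)%N.
(* The extra factor [k] makes the logarithm of the net size at most [n / k], hence negligible before
   [n]. *)
have [k [k0 koo Kle]] := slow_sequence
  (fun k => k%:R * ((D k)%:R * (ln ((C k)%:R : R) + 1))) nb_oo.
have est n := hist_estimator n (b_gt0 n) (k0 n) (cls_hist d _ _ d_gt0 (b_gt0 n) (k0 n)).
(* The estimator is fixed here, before [eps] and [p] are introduced. *)
pose V n := s2val (cid2 (est n)).
exists k, V; split => // [n|eps eps0]; first exact: (s2valP (cid2 (est n))).
(* Half of [eps] pays for [4 * t] and half for [3 / k], once [k >= 6 / eps]; the cap [2] is the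
   range of the deviation bound. *)
pose t : R := Num.min (eps / 8) 2.
have t0 : 0 < t by rewrite /t lt_min divr_gt0//=.
have t2 : t <= 2 by rewrite /t ge_min lexx orbT.
have teps : t <= eps / 8 by rewrite /t ge_min lexx.
have c0 : 0 < t ^+ 2 / 16 by rewrite divr_gt0// exprn_gt0.
have kbig (A : R) : \forall m \near \oo, A <= (k m)%:R.
  by move/cvgrnyP : koo => /(_ R)/cvgryPge.
(* Half of the Chernoff exponent [t ^+ 2 / 8] is reserved for absorbing the squared net size. *)
pose bound n : \bar R := (2 * expR (- (t ^+ 2 / 16 * n%:R)))%:E.
apply: (@squeeze_cvge _ _ _ _ (fun=> 0%E) _ bound).
- near=> n.
  have n0 : (0 < n)%N by near: n; exact: nbhs_infty_gt.
  have hk1 : 6 / eps <= (k n)%:R by near: n; exact: kbig.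
  (* With [Z] the bound on the logarithm of the net size, this gives
     [2 * Z <= 2 * n / k <= t ^+ 2 / 32 * n]. *)
  have hk2 : 64 / t ^+ 2 <= (k n)%:R by near: n; exact: kbig.
  have hb : expR 1 <= (b n)%:R :> R.
    by near: n; move/cvgrnyP : b_oo => /(_ R)/cvgryPge; exact.
  have hK : (k n)%:R * ((D (k n))%:R * (ln ((C (k n))%:R : R) + 1)) <=
      n%:R / ((b n)%:R * ln (b n)%:R) by near: n.
  have k0R : 0 < (k n)%:R :> R by rewrite ltr0n.
  have upper p : densities d p -> (sample_law n p [set X : n.-tuple (Rvec R d) |
      3%:E * best_approx (cls d (b n) (k n)) p + eps%:E < L1dist (V n X) p] <=
      bound n)%E.
    move=> dp.
    have keps : 3 / (k n)%:R + 4 * t <= eps.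
      have : 3 / (k n)%:R <= eps / 2.
        rewrite ler_pdivrMr//; move: hk1; rewrite ler_pdivrMr//; lra.
      lra.
    apply: le_trans (s2valP' (cid2 (est n)) p eps t dp n0 _ keps) _.
      by rewrite t0.
    rewrite lee_fin -mulrA ler_wpM2l//.
    set N := ((C (k n) * b n) ^ (D (k n) * b n))%N.
    have hN := hist_net_size_le (D (k n)) (ltn0Sn _ : (0 < C (k n))%N) hb.
    set Z := (_ * _) in hN.
    have B0 : 0 < (b n)%:R * ln (b n)%:R :> R.
      have b1 : 0 < (b n)%:R :> R by apply: lt_le_trans (expR_gt0 1) hb.
      rewrite mulr_gt0//; apply: lt_le_trans (ltr01) _.
      by rewrite -[leLHS]expRK ler_ln ?posrE ?expR_gt0.
    have hZ : 2 * Z <= t ^+ 2 / 16 * n%:R.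
      have kZ : (k n)%:R * Z <= n%:R by rewrite mulrA -ler_pdivlMr.
      have hk : 64 <= (k n)%:R * t ^+ 2 by rewrite -ler_pdivrMr// exprn_gt0.
      have n0R : 0 < n%:R :> R by rewrite ltr0n.
      rewrite -(ler_pM2l k0R); nra.
    apply: (@le_trans _ _ (expR (2 * Z) * expR (- (t ^+ 2 / 8) * n%:R))).
      rewrite ler_wpM2r ?expR_ge0// natrX (expRM_natl 2).
      by rewrite lerXn2r ?nnegrE ?expR_ge0.
    by rewrite -expRD ler_expR; lra.
  (* The supremum is nonnegative because densities exist; over an empty family it would be [-oo]. *)
  apply/andP; split.
    have [p dp] := densities_nonempty R d.
    apply: le_ereal_sup_tmp; eexists; first by exists p.
    by have [P PE _] := density_law_probability dp; rewrite /sample_law -PE.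
  by apply: ge_ereal_sup => _ [p dp <-]; exact: upper.
- exact: cvg_cst.
- apply: cvg_EFin; first exact: nearW.
  rewrite -[X in _ --> X](mulr0 2).
  have h : expR (- (t ^+ 2 / 16 * n%:R)) @[n --> \oo] --> (0 : R).
    apply: (cvg_comp (fun n => n%:R) (fun x => expR (- (t ^+ 2 / 16 * x))) (@cvgr_idn R)).
    apply: (cvg_comp (fun x => t ^+ 2 / 16 * x) (fun x => expR (- x))
      (gt0_cvgMry c0 cvg_id)).
    exact: cvgr_expR.
  exact: cvgM (cvg_cst _) h.
Unshelve. all: by end_near.
Qed.
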